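(* Let $V$ be a finite-dimensional real vector space and let $\varphi$ be a nondegenerate symmetric bilinear form on $V$ of signature $(p,q)$. (1) If $\mathrm{Rank}(\varphi)\ge 3$, then $G_{R_\varphi}=\{A\in GL(V) : A^*\varphi=\varphi \text{ or } A^*\varphi=-\varphi\}$. (2) If $\mathrm{Rank}(\varphi)\ge 3$ and $p\ne q$, then $G_{R_\varphi}=G_\varphi$. (3) If $\mathrm{Rank}(\varphi)=2$, then $G_{R_\varphi}=\{A\in GL(V) : \det(A)=\pm 1\}$. (4) If $\mathrm{Rank}(\varphi)\le 1$, then $R_\varphi=0$, so $G_{R_\varphi}=GL(V)$.
   Context: For a symmetric bilinear form $\varphi$ on $V$, define the 4-linear form $R_\varphi(x,y,z,w)=\varphi(x,w)\varphi(y,z)-\varphi(x,z)\varphi(y,w)$ on $V$. For $A\in GL(V)$ and an $s$-linear form $\alpha$ on $V$, put $(A^*\alpha)(x_1,\dots,x_s)=\alpha(Ax_1,\dots,Ax_s)$. The structure group of $\alpha$ is $G_\alpha=\{A\in GL(V): A^*\alpha=\alpha\}$. Signature $(p,q)$ means that a $\varphi$-orthonormal basis has $p$ vectors with $\varphi(e,e)=-1$ and $q$ vectors with $\varphi(e,e)=+1$. *)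

(* Defs.v *)
From mathcomp Require Import all_boot all_order all_algebra.
From mathcomp Require Import boolp classical_sets reals.

Set Implicit Arguments.
Unset Strict Implicit.
Unset Printing Implicit Defensive.

Import GRing.Theory Num.Theory.

Local Open Scope ring_scope.
Local Open Scope classical_set_scope.

Section StructureGroups.
Context {R : realType} {V : vectType R}.

(* An s-linear form on V is represented by its underlying function on families
   of s vectors indexed by 'I_s, so the arguments are numbered from 0. *)

Definition general_linear : set 'End(V) := [set A | bijective A].

Definition pullback (s : nat) (A : 'End(V)) (alpha : ('I_s -> V) -> R) :
    ('I_s -> V) -> R :=
  fun x => alpha (A \o x).

Definition structure_group (s : nat) (alpha : ('I_s -> V) -> R) :
    set 'End(V) :=
  [set A | general_linear A /\ pullback A alpha = alpha].

(* The determinant does not depend on the basis; [passmx.mxof] acts on row vectors,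
   so this is the determinant of the transpose of the usual matrix. *)
Definition lfun_det (A : 'End(V)) : R :=
  \det (passmx.mxof (vbasis {:V}) (vbasis {:V}) A).

Variable phi : {symmetric V}.

Definition two_form (x : 'I_2 -> V) : R := phi (x 0) (x 1).

Definition curvature_form (x : 'I_4 -> V) : R :=
  phi (x 0) (x 3) * phi (x 1) (x 2) - phi (x 0) (x 2) * phi (x 1) (x 3).

(* Rank of the Gram matrix, which does not depend on the basis. *)
Definition form_rank : nat :=
  \rank (\matrix_(i < \dim {:V}, j < \dim {:V})
           phi (vbasis {:V})`_i (vbasis {:V})`_j).

Definition phi_orthonormal_basis (e : seq V) : Prop :=
  [/\ basis_of {:V} e,
      {in e &, forall u v, u != v -> phi u v = 0} &
      {in e, forall u, phi u u = -1 \/ phi u u = 1}].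

(* p counts the negative vectors and q the positive ones. By Sylvester's law
   of inertia the counts are the same for every such basis. *)
Definition has_signature (p q : nat) : Prop :=
  exists e : seq V,
    [/\ phi_orthonormal_basis e,
        count (fun u => phi u u == -1) e = p &
        count (fun u => phi u u == 1) e = q].

End StructureGroups.

Arguments general_linear {R} V.

(* Main.v *)
Require Import Defs.
From mathcomp Require Import all_boot all_order all_algebra.
From mathcomp Require Import boolp classical_sets reals.
From mathcomp Require Import lra.

(** The curvature values of a form are the 2 by 2 minors of its Gram matrix, so
    the structure group of the curvature consists of the maps [A] for which
    [phi] and its pullback [psi x y = phi (A x) (A y)] have the same 2 by 2
    minors.

    In dimension at least 3, fix a [phi]-orthonormal basis and consider a 3 by 3
    principal block [M] of the Gram matrix of [psi]. Its adjugate is the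
    adjugate of a diagonal matrix with entries 1 and -1, so [M] is diagonal too
    ([curv_offdiag]); the products of its diagonal entries are prescribed, which
    fixes them up to a common sign ([curv_eq_sign]). Hence [psi = phi] or
    [psi = - phi], and conversely both signs disappear in the products.

    The case [psi = - phi] forces [p = q]: the image of the span of
    the positive basis vectors is negative definite, so it meets that span only
    in 0, whence [2 q <= p + q]; likewise [2 p <= p + q] ([anti_isometry_count]).

    In dimension 2 there is essentially one minor. The curvature is a nonzero
    multiple of the product of two area forms, so pulling back by [A] multiplies
    it by the square of the determinant of [A] ([curv_plane], [curv_dim2]). In
    dimension at most 1 there is no nonzero minor ([curv_line]).

    Since [phi] is nondegenerate, its rank is the dimension of the space
    ([form_rank_nondegenerate]). *)

Set Implicit Arguments.
Unset Strict Implicit.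
Unset Printing Implicit Defensive.

Import GRing.Theory Num.Theory.

Local Open Scope ring_scope.
Local Open Scope classical_set_scope.

Lemma third_member (T : eqType) (r : seq T) (a b : T) :
    uniq r -> (3 <= size r)%N ->
  exists c, [/\ c \in r, c != a & c != b].
Proof.
move=> ur r3; have [/hasP[c cr /norP[ca cb]]|] :=
  boolP (has (fun c => ~~ ((c == a) || (c == b))) r); first by exists c.
move=> /hasPn none; have: (size r <= size [:: a; b])%N.
  by apply: uniq_leq_size => // c /none /negPn; rewrite !inE.
by rewrite leqNgt r3.
Qed.

(** * Indices in dimension two *)

Section TwoByTwo.
(* The index type stays ['I_n] with a proof that [n = 2]: below, [n] is the
   dimension of a space, which is not a variable that could be replaced by 2. *)
Variables (R : realType) (n : nat) (i j : 'I_n).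
Hypotheses (n2 : n = 2) (nij : i != j).

Lemma sum_dim2 (W : nmodType) (F : 'I_n -> W) : \sum_k F k = F i + F j.
Proof.
rewrite (bigD1 i) //= (bigD1 j) /=; last by rewrite eq_sym.
rewrite big1 ?addr0 // => k /andP[ki kj].
have /card_uniqP card3 : uniq [:: i; j; k].
  by rewrite /= !inE negb_or nij eq_sym ki eq_sym kj.
by have := max_card (mem [:: i; j; k]); rewrite card3 card_ord /= [leqRHS]n2.
Qed.

Lemma det_dim2 (M : 'M[R]_n) : \det M = M i i * M j j - M i j * M j i.
Proof.
move: i j nij M; rewrite n2 => i' j' ij M.
rewrite (expand_det_row _ 0) !big_ord_recl big_ord0 addr0 /cofactor.
rewrite !det_mx11 !mxE /= expr0 expr1.
have cases (k : 'I_2) : k = 0 \/ k = 1.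
  by case: k => -[|[|//]] ?; [left | right]; apply: val_inj.
have -> : lift ord0 (ord0 : 'I_1) = 1 :> 'I_2 by apply: val_inj.
have -> : lift 1 (0 : 'I_1) = 0 :> 'I_2 by apply: val_inj.
by case: (cases i') ij => ->; case: (cases j') => -> //= _; lra.
Qed.

End TwoByTwo.

(** * The curvature expression of a bilinear form *)

Section Curv.
Variables (T : Type) (R : realType) (psi : T -> T -> R).
Implicit Types x y z w : T.

(** Defined for bare functions, so that it applies both to a form and to
    [fun x y => phi (A x) (A y)] without building a form structure on the
    latter. *)
Definition curv x y z w : R := psi x w * psi y z - psi x z * psi y w.

(** Expand the determinant of the 3 by 3 matrix with rows [x, z, x] and columns
    [x, y, z] along its last row: it vanishes, and the cofactors are curvature
    values, two of which vanish by assumption. *)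
Lemma curv_offdiag x y z :
  curv x z x y = 0 -> curv x z y z = 0 -> curv x z x z != 0 -> psi x y = 0.
Proof.
move=> xy0 yz0 xz0; apply: (mulIf xz0); rewrite mul0r.
have -> : psi x y * curv x z x z =
    psi x z * curv x z x y + psi x x * curv x z y z.
  by rewrite /curv; lra.
by rewrite xy0 yz0 !mulr0 addr0.
Qed.

End Curv.

(** * Symmetric bilinear forms *)

Section Forms.
Variables (R : realType) (V : vectType R) (phi : {symmetric V}).
Implicit Types (A : 'End(V)) (x y z w u v : V) (e : seq V) (s : R).

Lemma formC x y : phi x y = phi y x.
Proof. by rewrite hermC expr0 mul1r. Qed.

Lemma formDl x y z : phi (x + y) z = phi x z + phi y z.
Proof. exact: linearDl. Qed.

Lemma formZl a x z : phi (a *: x) z = a * phi x z.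
Proof. exact: linearZl_LR. Qed.

Lemma formDr x y z : phi z (x + y) = phi z x + phi z y.
Proof. exact: linearDr. Qed.

Lemma formZr a x z : phi z (a *: x) = a * phi z x.
Proof. exact: linearZr_LR. Qed.

Lemma form_suml (I : finType) (F : I -> V) z :
  phi (\sum_i F i) z = \sum_i phi (F i) z.
Proof. exact: linear_sumlz. Qed.

Lemma form_sumr (I : finType) (F : I -> V) z :
  phi z (\sum_i F i) = \sum_i phi z (F i).
Proof. exact: linear_sumr. Qed.

Lemma pullback_curvatureP A :
  pullback A (curvature_form phi) = curvature_form phi <->
  forall x y z w, curv phi (A x) (A y) (A z) (A w) = curv phi x y z w.
Proof.
split=> [eqR x y z w | eqR]; last by apply/funext=> t; exact: eqR.
exact: (congr1 (fun f => f (tnth [tuple x; y; z; w])) eqR).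
Qed.

Lemma pullback_two_formP A s :
  pullback A (two_form phi) = (fun t => s * two_form phi t) <->
  forall x y, phi (A x) (A y) = s * phi x y.
Proof.
split=> [eqphi x y | eqphi]; last by apply/funext=> t; exact: eqphi.
exact: (congr1 (fun f => f (tnth [tuple x; y])) eqphi).
Qed.

Lemma two_form_scale1 : two_form phi = (fun t => 1 * two_form phi t).
Proof. by apply/funext=> t; rewrite mul1r. Qed.

Lemma two_form_scaleN1 : \- two_form phi = (fun t => -1 * two_form phi t).
Proof. by apply/funext=> t; rewrite mulN1r. Qed.

(** * Rank at least three *)

Lemma similitude_on_basis A s e : basis_of {:V} e ->
  {in e &, forall u v, phi (A u) (A v) = s * phi u v} ->
  forall x y, phi (A x) (A y) = s * phi x y.
Proof.
move=> be Ae x y; have be' : basis_of {:V} (in_tuple e) by [].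
rewrite (coord_basis be' (memvf x)) (coord_basis be' (memvf y)) !(linear_sum A) /=.
rewrite !form_suml mulr_sumr; apply: eq_bigr => i _.
rewrite !form_sumr mulr_sumr; apply: eq_bigr => j _.
rewrite ![A (_ *: _)]linearZ /= !formZl !formZr Ae ?mem_nth //; lra.
Qed.

(** In an orthonormal basis of at least three vectors, a function with the same
    curvature as [phi] is diagonal by [curv_offdiag], any third vector serving
    as [z]. The curvature then gives the products of two distinct diagonal
    entries; with three indices available these products determine the diagonal
    up to a global sign. *)
Lemma curv_eq_sign (e : seq V) (psi : V -> V -> R) :
    phi_orthonormal_basis phi e -> (3 <= size e)%N ->
    {in e, forall x, {in e, forall y, {in e & e, forall z w,
      curv psi x y z w = curv phi x y z w}}} ->
  exists2 s, s = 1 \/ s = -1 & {in e &, forall u v, psi u v = s * phi u v}.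
Proof.
move=> [be oe ne] e3 eqR; have ue : uniq e := free_uniq (basis_free be).
have nz u : u \in e -> phi u u != 0.
  by move=> /ne [] ->; rewrite ?oppr_eq0 oner_eq0.
have sq u : u \in e -> phi u u * phi u u = 1.
  by move=> /ne [] ->; rewrite ?mulrNN mulr1.
have off x y : x \in e -> y \in e -> x != y -> psi x y = 0.
  move=> xe ye xy; have [z [ze zx zy]] := third_member x y ue e3.
  have phi_xz : phi x z = 0 by apply: oe; rewrite // eq_sym.
  have phi0 := (oe _ _ xe ye xy, oe _ _ ze xe zx, oe _ _ ze ye zy, phi_xz).
  apply: (curv_offdiag (z := z)); rewrite eqR // /curv !phi0.
  - by rewrite ?(mul0r, mulr0) subrr.
  - by rewrite ?(mul0r, mulr0) subrr.
  - by rewrite mul0r sub0r oppr_eq0 mulf_neq0 ?nz.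
have diag x y : x \in e -> y \in e -> x != y ->
    psi x x * psi y y = phi x x * phi y y.
  move=> xe ye xy; have := eqR x xe y ye y x ye xe.
  by rewrite /curv !(off _ _ xe ye xy) !(oe _ _ xe ye xy) !mul0r !subr0.
have [a ae] : exists a, a \in e.
  by case: (e) e3 => // a r _; exists a; exact: mem_head.
(* Two further indices [u] and [z] are needed to isolate [psi a a]. *)
have psi_a : psi a a * psi a a = 1.
  have [u [ue' ua _]] := third_member a a ue e3.
  have [z [ze za zu]] := third_member a u ue e3.
  have := diag _ _ ae ue'; have := diag _ _ ae ze; have := diag _ _ ue' ze.
  rewrite ![a == _]eq_sym [u == z]eq_sym => /(_ zu) uz /(_ za) az /(_ ua) au.
  (* psi(a,a)^2 psi(u,u) psi(z,z) is a product of two products known from phi. *)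
  apply: (mulIf (mulf_neq0 (nz _ ue') (nz _ ze))).
  by rewrite -{1}uz mulrACA au az mulrACA sq.
exists (psi a a * phi a a).
  have : (psi a a * phi a a) ^+ 2 = 1.
    by rewrite expr2 mulrACA psi_a sq // mulr1.
  by move/eqP; rewrite sqrf_eq1 => /orP[] /eqP ->; [left | right].
move=> u v ue' ve; have [<-{ve v}|uv] := eqVneq u v; last first.
  by rewrite off // (oe _ _ ue' ve uv) mulr0.
have [->|ua] := eqVneq u a; first by rewrite -mulrA sq // mulr1.
have := diag _ _ ae ue'; rewrite eq_sym => /(_ ua) au.
by rewrite -mulrA -au mulrA psi_a mul1r.
Qed.

Lemma curv_similitude A s : s * s = 1 ->
  (forall x y, phi (A x) (A y) = s * phi x y) ->
  forall x y z w, curv phi (A x) (A y) (A z) (A w) = curv phi x y z w.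
Proof.
move=> s1 As x y z w.
have sE a b : s * a * (s * b) = a * b by rewrite mulrACA s1 mul1r.
by rewrite /curv !As !sE.
Qed.

(** * Isometries onto the opposite form *)

Lemma form_on_definite_span (n : nat) (X : n.-tuple V) s v :
    {in X &, forall x y, x != y -> phi x y = 0} -> {in X, forall x, phi x x = s} ->
    free X -> v \in <<X>>%VS ->
  phi v v = s * \sum_i coord X i v ^+ 2.
Proof.
move=> oX nX fX vX; rewrite {1 2}(coord_span vX) form_suml mulr_sumr.
apply: eq_bigr => i _; rewrite form_sumr (bigD1 i) //= big1 ?addr0 => [|j ji].
  by rewrite formZl formZr nX ?mem_nth ?size_tuple //; lra.
rewrite formZl formZr oX ?mulr0 ?mem_nth ?size_tuple //.
by rewrite nth_uniq ?size_tuple ?free_uniq // eq_sym.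
Qed.

(** On the span of the vectors of square [s] the form is definite with the sign
    of [s]; on the image of this span under [A] it is definite with the opposite
    sign. The two subspaces have the same dimension and meet only in 0. *)
Lemma anti_isometry_count A e s : s = 1 \/ s = -1 ->
    phi_orthonormal_basis phi e -> lker A == 0%VS ->
    (forall x y, phi (A x) (A y) = - phi x y) ->
  (2 * count (fun u => phi u u == s) e <= size e)%N.
Proof.
move=> s1 [be oe ne] kA AN; set X := filter (fun u => phi u u == s) e.
have fX : free (in_tuple X) by rewrite filter_free // (basis_free be).
have phiX v : v \in <<X>>%VS -> phi v v = s * \sum_i coord (in_tuple X) i v ^+ 2.
  move=> vX; apply: form_on_definite_span => //= [x y|x]; rewrite !mem_filter.
    by move=> /andP[_ xe] /andP[_ ye]; exact: oe.
  by case/andP=> /eqP.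
have disj : (<<X>> :&: A @: <<X>> = 0)%VS.
  apply/eqP; rewrite -subv0; apply/subvP => v /memv_capP[vX /memv_imgP[u uX vE]].
  have s0 : s != 0 by case: s1 => ->; rewrite ?oppr_eq0 oner_eq0.
  have := phiX v vX; rewrite {1 2}vE AN phiX // -mulrN => /(mulfI s0) /esym.
  move/eqP; rewrite -subr_eq0 opprK => sum0.
  have : \sum_i coord (in_tuple X) i v ^+ 2 == 0.
    move: sum0; rewrite paddr_eq0; first by case/andP.
      by apply: sumr_ge0 => i _; exact: sqr_ge0.
    by apply: sumr_ge0 => i _; exact: sqr_ge0.
  rewrite psumr_eq0 => [/allP z0|i _]; last exact: sqr_ge0.
  rewrite memv0 (coord_span (X := in_tuple X) vX) big1 // => i _.
  have := z0 i; rewrite mem_index_enum sqrf_eq0 => /(_ isT) /eqP ->.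
  by rewrite scale0r.
have dX : \dim <<X>>%VS = count (fun u => phi u u == s) e.
  by rewrite -size_filter; apply/eqP.
rewrite -dX mul2n -addnn -{2}(@limg_dim_eq _ _ _ A); last first.
  by rewrite (eqP kA) capv0.
rewrite -dimv_disjoint_sum // -[leqRHS](size_basis (X := in_tuple e) be).
by rewrite dimvS // subvf.
Qed.

Lemma signature_size e p q : phi_orthonormal_basis phi e ->
    count (fun u => phi u u == -1) e = p -> count (fun u => phi u u == 1) e = q ->
  size e = (p + q)%N.
Proof.
move=> [_ _ ne] <- <-; rewrite -[LHS](count_predC (fun u => phi u u == -1)).
congr (_ + _)%N; apply: eq_in_count => u /ne /= [] ->.
  by rewrite eqxx eqNr oner_eq0.
by rewrite eqxx eq_sym eqNr oner_eq0.
Qed.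

(** * Dimension at most two *)

(** A row vector killed by the Gram matrix is the coordinate vector of an element
    of the radical. *)
Lemma form_rank_nondegenerate : nondegenerate phi -> form_rank phi = \dim {:V}.
Proof.
move=> /eqP nd; apply/eqP; apply: inj_row_free => c cG.
apply/eqP; rewrite -(passmx.vecof_eq0 (vbasisP {:V})) -memv0 -nd.
apply/mem_orthovP => w _; set v := passmx.vecof _ _.
rewrite -[LHS]/(phi v w) (coord_vbasis (memvf w)) form_sumr big1 // => j _.
rewrite formZr /v /passmx.vecof form_suml.
apply/eqP; rewrite mulf_eq0; apply/orP; right; apply/eqP.
have := congr1 (fun M : 'rV_ _ => M 0 j) cG; rewrite !mxE => cG0.
rewrite -[RHS]cG0.
by apply: eq_bigr => i _; rewrite formZl !mxE.
Qed.

(** On a plane, the curvature is a product of two determinants: this is why a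
    linear map multiplies it by the square of its own determinant. *)
Lemma curv_plane (a1 a2 b1 b2 c1 c2 d1 d2 : R) u v :
  curv phi (a1 *: u + a2 *: v) (b1 *: u + b2 *: v)
           (c1 *: u + c2 *: v) (d1 *: u + d2 *: v) =
  (a1 * b2 - a2 * b1) * (c1 * d2 - c2 * d1) * curv phi u v u v.
Proof.
by rewrite /curv !formDl !formDr !formZl !formZr (formC v u); lra.
Qed.

Lemma curv_line u (a b c d : R) :
  curv phi (a *: u) (b *: u) (c *: u) (d *: u) = 0.
Proof. by rewrite /curv !formZl !formZr; lra. Qed.

(** By [curv_plane], pulling back by [A] multiplies the curvature by
    [lfun_det A ^+ 2]. This factor must be 1 because the curvature of a basis is,
    up to sign, the determinant of the Gram matrix, hence nonzero. *)
Lemma curv_dim2 A : nondegenerate phi -> \dim {:V} = 2 ->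
  (forall x y z w, curv phi (A x) (A y) (A z) (A w) = curv phi x y z w) <->
  lfun_det A = 1 \/ lfun_det A = -1.
Proof.
move=> nd d2; set b := vbasis {:V}.
pose i : 'I_(\dim {:V}) := cast_ord (esym d2) 0.
pose j : 'I_(\dim {:V}) := cast_ord (esym d2) 1.
have nij : i != j by [].
have coordE x : exists c : R * R, x = c.1 *: b`_i + c.2 *: b`_j.
  exists (coord b i x, coord b j x).
  by rewrite {1}(coord_vbasis (memvf x)) (sum_dim2 d2 nij).
have K0 : curv phi b`_i b`_j b`_i b`_j != 0.
  have := form_rank_nondegenerate nd; rewrite /form_rank.
  set G := \matrix_(_, _) _ => rG.
  have : G \in unitmx by rewrite -row_full_unit /row_full rG.
  rewrite unitmxE unitfE (det_dim2 d2 nij) !mxE /curv -/b; apply: contra_neq => E.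
  by rewrite -(opprK (_ - _)) opprB -[RHS]oppr0 -E; congr (- (_ - _)).
pose M := passmx.mxof b b A.
have AbE (k : 'I_(\dim {:V})) : A b`_k = M k i *: b`_i + M k j *: b`_j.
  have bb := vbasisP {:V}.
  rewrite -(passmx.vecof_delta b k) (passmx.hom_vecof b bb) -/M /passmx.vecof.
  by rewrite (sum_dim2 d2 nij) -rowE !mxE.
have AlinE a c : A (a *: b`_i + c *: b`_j) = a *: A b`_i + c *: A b`_j.
  by rewrite linearD !linearZ.
have detE x y z w : curv phi (A x) (A y) (A z) (A w) =
    lfun_det A ^+ 2 * curv phi x y z w.
  have [cx ->] := coordE x; have [cy ->] := coordE y.
  have [cz ->] := coordE z; have [cw ->] := coordE w.
  rewrite !AlinE !curv_plane !AbE curv_plane.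
  by rewrite /lfun_det (det_dim2 d2 nij) -/b -/M; lra.
split=> [AR | detA x y z w].
  have := AR b`_i b`_j b`_i b`_j; rewrite detE -[RHS]mul1r => /(mulIf K0) /eqP.
  by rewrite sqrf_eq1 => /orP[] /eqP ->; [left | right].
by rewrite detE; case: detA => ->; rewrite ?sqrrN expr1n mul1r.
Qed.

End Forms.

Theorem theorem1p5 (R : realType) (V : vectType R) (phi : {symmetric V})
    (p q : nat) (phi_nondeg : nondegenerate phi)
    (phi_sign : has_signature phi p q) :
  [/\ (3 <= form_rank phi)%N ->
        structure_group (curvature_form phi) =
        [set A | general_linear V A /\
           (pullback A (two_form phi) = two_form phi \/
            pullback A (two_form phi) = \- two_form phi)],
      (3 <= form_rank phi)%N -> p <> q ->
        structure_group (curvature_form phi) = structure_group (two_form phi),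
      form_rank phi = 2%N ->
        structure_group (curvature_form phi) =
        [set A | general_linear V A /\ (lfun_det A = 1 \/ lfun_det A = -1)] &
      (form_rank phi <= 1)%N ->
        curvature_form phi = (fun=> 0) /\
        structure_group (curvature_form phi) = general_linear V].
Proof.
have [e [oe ep eq_q]] := phi_sign; have [be _ _] := oe.
have se : size e = form_rank phi.
  by rewrite form_rank_nondegenerate // (size_basis (X := in_tuple e) be).
have part1 : (3 <= form_rank phi)%N ->
    structure_group (curvature_form phi) =
    [set A | general_linear V A /\
       (pullback A (two_form phi) = two_form phi \/
        pullback A (two_form phi) = \- two_form phi)].
  move=> rk3; apply/seteqP; split=> A [bA].
    move/pullback_curvatureP => AR; split => //.
    have [||s s1 As] := @curv_eq_sign _ _ phi e (fun x y => phi (A x) (A y)) oe.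
    - by rewrite se.
    - by move=> x _ y _ z w _ _; exact: AR.
    have /pullback_two_formP -> := similitude_on_basis be As.
    by case: s1 => ->; [left | right];
      rewrite ?two_form_scaleN1 -?two_form_scale1.
  move=> Aphi; split => //; apply/pullback_curvatureP.
  case: Aphi => [Aphi|].
    apply: (@curv_similitude _ _ phi A 1); first by rewrite mulr1.
    by apply/pullback_two_formP; rewrite -two_form_scale1.
  rewrite two_form_scaleN1 => /pullback_two_formP.
  by apply: curv_similitude; rewrite mulrNN mulr1.
split=> // [rk3 pq | rk2 | rk1].
- rewrite (part1 rk3); apply/seteqP; split=> A [bA].
    case=> [? // | ]; rewrite two_form_scaleN1 => /pullback_two_formP AN.
    have kA : lker A == 0%VS by apply/lker0P; exact: bij_inj.
    have {}AN x y : phi (A x) (A y) = - phi x y by rewrite AN mulN1r.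
    case: pq; apply/eqP; rewrite eqn_leq.
    have := anti_isometry_count (or_introl erefl) oe kA AN.
    have := anti_isometry_count (or_intror erefl) oe kA AN.
    rewrite ep eq_q (signature_size oe ep eq_q) !mul2n -!addnn.
    by rewrite leq_add2l leq_add2r => -> ->.
  by move=> ?; split => //; left.
- have d2 : \dim {:V} = 2 by rewrite -(form_rank_nondegenerate phi_nondeg).
  apply/seteqP; split=> A [bA].
    by move/pullback_curvatureP/(curv_dim2 A phi_nondeg d2).
  by move/(curv_dim2 A phi_nondeg d2)/pullback_curvatureP.
have R0 : curvature_form phi = (fun=> 0).
  have [u uE] : exists u, forall x : V, exists c : R, x = c *: u.
    exists e`_0 => x; have: x \in <<e>>%VS by rewrite (span_basis be) memvf.
    move: se rk1 => <-; case: (e) => [|u [|//]] _.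
      by rewrite span_nil memv0 => /eqP ->; exists 0; rewrite scale0r.
    by rewrite span_seq1 => /vlineP.
  apply/funext=> t; have [a ta] := uE (t 0); have [b tb] := uE (t 1).
  have [c tc] := uE (t 2%:R); have [d td] := uE (t 3%:R).
  by rewrite -(curv_line phi u a b c d) -ta -tb -tc -td.
split=> //; apply/seteqP; split=> A; first by case.
by move=> bA; split => //; rewrite R0.
Qed.
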